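(* Suppose there exists a quadruple system $Q$ of order $v$ and a $\delta$-colouring of its points such that each block receives at least $3$ distinct colours. Then there exists a Kirkman triple system $K(Q)$ of order $2v+1$ that is $(\delta+1)$-colourable.
   Context: A quadruple system of order $v$ is a set of $v$ points with a set of $4$-subsets (blocks) such that each pair of points lies in exactly one block. Given a quadruple system $Q$ on points $\{q_0,\dots,q_{v-1}\}$, a $K(Q)$ is a Kirkman triple system (Steiner triple system with a partition of its triples into parallel classes) on $\{\infty\}\cup\{q_i,q_i' : 0\le i\le v-1\}$ obtained by placing, for each block $\{w,x,y,z\}$ of $Q$, the triples of a KTS$(9)$ on $\{\infty,w,x,y,z,w',x',y',z'\}$ so that the triples containing $\infty$ are $\{\infty,w,w'\},\{\infty,x,x'\},\{\infty,y,y'\},\{\infty,z,z'\}$ (the placement is not unique). A $\delta$-colouring is a map from the points to a set of $\delta$ colours; a design is $\delta$-colourable if it has a $\delta$-colouring with no monochromatic block. *)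

(* Defs.v *)
From mathcomp Require Import all_boot.

Set Implicit Arguments.
Unset Strict Implicit.
Unset Printing Implicit Defensive.

Section Designs.
Variable T : finType.
Implicit Types (X b : {set T}) (B C : {set {set T}}) (R : {set {set {set T}}}).

Definition design (k v : nat) X B : Prop :=
  [/\ #|X| = v,
      forall b, b \in B -> b \subset X /\ #|b| = k
    & forall x y, x \in X -> y \in X -> x != y ->
        #|[set b in B | (x \in b) && (y \in b)]| = 1].

Definition quadruple_system (v : nat) X B : Prop := design 4 v X B.

Definition steiner_triple_system (v : nat) X B : Prop := design 3 v X B.

Definition parallel_class X B C : Prop := C \subset B /\ partition C X.

Definition resolution X B R : Prop :=
  partition R B /\ forall C, C \in R -> parallel_class X B C.

Definition kirkman_triple_system (v : nat) X B R : Prop :=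
  steiner_triple_system v X B /\ resolution X B R.

Definition monochromatic (d : nat) (c : T -> 'I_d) b : Prop :=
  {in b &, forall x y, c x = c y}.

(* For designs whose point set is all of T. *)
Definition colourable (d : nat) B : Prop :=
  exists c : T -> 'I_d, forall b, b \in B -> ~ monochromatic c b.

End Designs.

Section KQ.
Variable T : finType.
Implicit Types (b : {set T}) (Q : {set {set T}}).

(* [None] is the point infinity, [Some (q, false)] is q and [Some (q, true)]
   is q'. *)
Definition kpoint : finType := option (T * bool).

Definition infty : kpoint := None.
Definition plain (q : T) : kpoint := Some (q, false).
Definition primed (q : T) : kpoint := Some (q, true).

Definition inf_triple (q : T) : {set kpoint} := [set infty; plain q; primed q].

Definition kpoints_of b : {set kpoint} :=
  infty |: ([set plain q | q in b] :|: [set primed q | q in b]).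

Definition placement b (P : {set {set kpoint}}) : Prop :=
  (exists S, kirkman_triple_system 9 (kpoints_of b) P S) /\
  [set t in P | infty \in t] = [set inf_triple q | q in b].

(* The triples {infinity, q, q'} already lie in the union of the placements as
   soon as every point is on a block; they are listed separately only so that
   the system of order 1, which has no block, yields the triple system of
   order 3 (see [KQ_triplesE]). *)
Definition KQ_triples Q (P : {set T} -> {set {set kpoint}}) :
    {set {set kpoint}} :=
  [set inf_triple q | q in [set: T]] :|: \bigcup_(b in Q) P b.

Definition is_KQ Q (K : {set {set kpoint}}) (R : {set {set {set kpoint}}}) :
    Prop :=
  kirkman_triple_system (2 * #|T| + 1) [set: kpoint] K R /\
  exists P : {set T} -> {set {set kpoint}},
    (forall b, b \in Q -> placement b (P b)) /\ K = KQ_triples Q P.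

Lemma KQ_triplesE (v : nat) Q (P : {set T} -> {set {set kpoint}}) :
  quadruple_system v [set: T] Q -> v != 1 ->
  (forall b, b \in Q -> placement b (P b)) ->
  KQ_triples Q P = \bigcup_(b in Q) P b.
Proof.
move=> [cT _ pairQ] v1 plP; apply/setUidPr/subsetP => _ /imsetP[q _ ->].
have /card_gt0P[y /setD1P[yq _]] : 0 < #|[set: T] :\ q|.
  have := cardsD1 q [set: T]; rewrite in_setT cT.
  by case: #|_ :\ q| v1 => // /negP H E; case: H; rewrite E.
have /card_gt0P[b] : 0 < #|[set b in Q | (q \in b) && (y \in b)]|.
  by rewrite pairQ ?inE // eq_sym.
rewrite inE => /and3P[bQ qb _]; apply/bigcupP; exists b => //.
have [_ E] := plP b bQ.
have : inf_triple q \in [set inf_triple q | q in b] by apply: imset_f.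
by rewrite -E inE => /andP[].
Qed.

End KQ.

(* Main.v *)
Require Import Defs.
From mathcomp Require Import all_boot.

Set Implicit Arguments.
Unset Strict Implicit.
Unset Printing Implicit Defensive.

(** Identify the KTS(9) on a block [b] with the affine plane AG(2,3), the point
    infinity being the origin and [q'] being [-q]. A line missing the origin is
    parallel to exactly one line [{infinity, q, q'}] with [q] in [b], and it
    contains exactly one of [y], [y'] for each of the three other points [y] of
    [b]. Hence the triples parallel to [{infinity, q, q'}], taken over all the
    blocks through [q], form a parallel class of the whole system. Give [q] and
    [q'] the colour of [q], and infinity a new colour: as a block receives at
    least three colours, no three of its points have the same colour, so no
    triple is monochromatic. *)

(** * Pointwise criteria for partitions and singletons *)

Section FiniteSets.
Variable T : finType.

Lemma partition_unique (P : {set {set T}}) (D : {set T}) :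
  (forall A, A \in P -> A \subset D) -> (forall A, A \in P -> A != set0) ->
  (forall x, x \in D -> exists2 A, A \in P & x \in A) ->
  (forall x A B, A \in P -> B \in P -> x \in A -> x \in B -> A = B) ->
  partition P D.
Proof.
move=> sub ne cov uni; apply/and3P; split.
- rewrite eqEsubset; apply/andP; split; first by apply/bigcupsP.
  by apply/subsetP => x /cov[A AP xA]; apply/bigcupP; exists A.
- apply/trivIsetP => A B AP BP /eqP neq; rewrite -setI_eq0.
  by apply/set0Pn => -[x /setIP[xA xB]]; apply/neq/(uni x).
- by apply/negP => /ne; rewrite eqxx.
Qed.

Lemma card1_unique (A : {set T}) x :
  x \in A -> (forall y, y \in A -> y = x) -> #|A| = 1.
Proof.
move=> xA uni; apply/eqP/cards1P; exists x; apply/setP => y; rewrite inE.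
by apply/idP/eqP => [/uni|->].
Qed.

End FiniteSets.

(** * Two points determine their block *)

Section Blocks.
Variables (T : finType) (k v : nat) (X : {set T}) (B : {set {set T}}).
Hypothesis desB : design k v X B.

Lemma design_block x y : x \in X -> y \in X -> x != y ->
  exists2 b, b \in B & (x \in b) && (y \in b).
Proof.
case: desB => _ _ pairB xX yX xy.
have /eqP/cards1P[b E] := pairB x y xX yX xy.
by have := set11 b; rewrite -E inE => /andP[bB xyb]; exists b.
Qed.

Lemma design_block_mem b x : b \in B -> x \in b -> x \in X.
Proof. by case: desB => _ bX _ /bX[/subsetP + _]; apply. Qed.

Lemma design_block_inj x y b1 b2 : x != y -> b1 \in B -> b2 \in B ->
  x \in b1 -> y \in b1 -> x \in b2 -> y \in b2 -> b1 = b2.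
Proof.
case: (desB) => _ _ pairB xy b1B b2B x1 y1 x2 y2.
have xX := design_block_mem b1B x1; have yX := design_block_mem b1B y1.
have /eqP/cards1P[b /setP E] := pairB x y xX yX xy.
have := E b1; rewrite !inE b1B x1 y1 => /esym/eqP->.
by have := E b2; rewrite !inE b2B x2 y2 => /esym/eqP->.
Qed.

End Blocks.

(** * Lines of the affine plane placed on a block *)

Section Lines.
Variable T : finType.
Implicit Types (b X : {set T}) (Q : {set {set T}}) (t : {set kpoint T}).

(* The points of a block are placed at (1,0), (0,1), (1,1), (1,-1) in AG(2,3).
   One of the two other lines parallel to the line of the i-th point contains,
   for j <> i, the opposite of the j-th point if [sign_table i j], and the j-th
   point otherwise. *)
Definition sign_table (i j : nat) : bool :=
  (i, j) \in [:: (0, 3); (2, 1); (2, 3); (3, 2)].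

(** The line joining point k to point l and the line joining k to the opposite of l have the
    directions i and j, in some order. So k and l have equal signs for one of these directions and
    different signs for the other. *)
Lemma sign_table_split (i j k l : 'I_4) : uniq [:: i; j; k; l] ->
  sign_table i k (+) sign_table i l != sign_table j k (+) sign_table j l.
Proof.
by case: i j k l => [[|[|[|[|//]]]] ?] [[|[|[|[|//]]]] ?] [[|[|[|[|//]]]] ?]
  [[|[|[|[|//]]]] ?].
Qed.

(** Any numbering of the four points of [b] would do; [enum b] supplies one. *)
Definition sign b (q y : T) : bool :=
  sign_table (index q (enum b)) (index y (enum b)).

Lemma sign_split b q1 q2 y z : #|b| = 4 ->
  [/\ q1 \in b, q2 \in b, y \in b & z \in b] -> uniq [:: q1; q2; y; z] ->
  sign b q1 y (+) sign b q1 z != sign b q2 y (+) sign b q2 z.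
Proof.
move=> cb [b1 b2 by_ bz] u.
have lt x : x \in b -> index x (enum b) < 4.
  by rewrite -cb cardE index_mem mem_enum.
apply: (@sign_table_split (Ordinal (lt _ b1)) (Ordinal (lt _ b2))
          (Ordinal (lt _ by_)) (Ordinal (lt _ bz))).
rewrite -(map_inj_uniq val_inj).
rewrite (_ : map _ _ = map (index^~ (enum b)) [:: q1; q2; y; z]) //.
have sb : {subset [:: q1; q2; y; z] <= enum b}.
  by move=> x; rewrite mem_enum !inE => /or4P[] /eqP->.
by rewrite map_inj_in_uniq // => x x' /sb xb /sb x'b; apply: (index_inj q1).
Qed.

(** For [q] in a block [b], the two values of [e] give the two lines parallel to [inf_triple q] that
    miss infinity; each is the opposite of the other. *)
Definition line b (q : T) (e : bool) : {set kpoint T} :=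
  [set Some (y, e (+) sign b q y) | y in b :\ q].

Lemma in_line b q e y s :
  (Some (y, s) \in line b q e) = [&& y != q, y \in b & s == e (+) sign b q y].
Proof.
apply/imsetP/and3P => [[x /setD1P[xq xb] [-> ->]]|[yq yb /eqP->]] //.
by exists y => //; apply/setD1P.
Qed.

Lemma infty_line b q e : infty T \in line b q e = false.
Proof. by apply/imsetP => -[]. Qed.

Lemma mem_line b q e y : y != q -> y \in b ->
  Some (y, e (+) sign b q y) \in line b q e.
Proof. by rewrite in_line eqxx => -> ->. Qed.

Lemma card_line b q e : #|b| = 4 -> q \in b -> #|line b q e| = 3.
Proof.
move=> cb qb; rewrite card_imset => [|x y []//].
by apply: succn_inj; rewrite -cb (cardsD1 q b) qb.
Qed.

Lemma in_inf_triple (q : T) (p : kpoint T) :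
  (p \in inf_triple q) = if p is Some ys then ys.1 == q else true.
Proof.
rewrite !inE; case: p => [[y s]|] //=.
have eS (x z : T * bool) : (Some x == Some z) = (x == z) by [].
by rewrite /plain /primed !eS !xpair_eqE; case: s; rewrite ?andbT ?andbF ?orbF.
Qed.

Lemma card_inf_triple (q : T) : #|inf_triple q| = 3.
Proof.
have pq : plain q != primed q by apply/eqP => -[].
by rewrite /inf_triple -setUA cardsU1 cards2 !inE pq.
Qed.

Lemma inf_triple_inj : injective (@inf_triple T).
Proof.
move=> q1 q2 /setP/(_ (plain q1)).
by rewrite !in_inf_triple /= eqxx => /esym/eqP.
Qed.

Lemma inf_triple_neq_line (q0 : T) b q e : inf_triple q0 <> line b q e.
Proof. by move/setP/(_ (infty T)); rewrite in_inf_triple infty_line. Qed.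

Lemma in_kpoints_of X (p : kpoint T) :
  (p \in kpoints_of X) = if p is Some ys then ys.1 \in X else true.
Proof.
rewrite !inE; case: p => [[y s]|] //=.
apply/orP/idP => [[/imsetP[q qX [->]]|/imsetP[q qX [->]]]|yX] //.
by case: s; [right|left]; apply: imset_f.
Qed.

Lemma card_kpoints_of X : #|kpoints_of X| = 2 * #|X| + 1.
Proof.
have -> : kpoints_of X = infty T |: [set Some ys | ys in setX X [set: bool]].
  apply/setP => p; rewrite in_kpoints_of !inE.
  case: p => [[y s]|] //=; apply/idP/imsetP => [yX|[[x r] + [-> _]]].
    by exists (y, s); rewrite ?inE ?yX.
  by rewrite !inE andbT.
rewrite cardsU1 card_imset; last by move=> x y [].
rewrite cardsX cardsT card_bool mulnC addnC.
by case: imsetP => // -[].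
Qed.

Definition par_class Q (q : T) : {set {set kpoint T}} :=
  inf_triple q |: [set line be.1 q be.2 | be in [set be : {set T} * bool |
                     (be.1 \in Q) && (q \in be.1)]].

Variant par_class_spec Q q t : Prop :=
  | ParInf of t = inf_triple q
  | ParLine b e of b \in Q & q \in b & t = line b q e.

Lemma par_classP Q q t : reflect (par_class_spec Q q t) (t \in par_class Q q).
Proof.
apply: (iffP setU1P) => [[->|/imsetP[[b e]]]|[->|b e bQ qb ->]].
- exact: ParInf.
- by rewrite inE => /andP[/= bQ qb ->]; apply: (ParLine bQ qb).
- by left.
- by right; apply/imsetP; exists (b, e); rewrite // inE /= bQ.
Qed.

(* With [X := b] and [Q := [set b]] this is the KTS(9) placed on a block [b]. *)
Definition ktriples X Q := \bigcup_(q in X) par_class Q q.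

Definition kclasses X Q := [set par_class Q q | q in X].

(** * The Kirkman triple system of a quadruple system *)

Section QuadrupleSystem.
Variables (v : nat) (X : {set T}) (Q : {set {set T}}).
Hypothesis hQ : quadruple_system v X Q.

Let card_block b : b \in Q -> #|b| = 4.
Proof. by case: hQ => _ bX _ /bX[]. Qed.

Let block_mem b x : b \in Q -> x \in b -> x \in X.
Proof. exact: (design_block_mem hQ). Qed.

Lemma two_other_points b y z : b \in Q -> y \in b -> z \in b -> y != z ->
  exists q1 q2, [/\ q1 \in b, q2 \in b, uniq [:: q1; q2; y; z]
    & forall q, q \in b -> q != y -> q != z -> (q == q1) || (q == q2)].
Proof.
move=> bQ yb zb yz.
have /eqP/cards2P[q1 [q2 [q12 E]]] : #|b :\ y :\ z| = 2.
  have := cardsD1 y b; have := cardsD1 z (b :\ y).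
  by rewrite !inE yb zb (eq_sym z) yz (card_block bQ) => -> [].
have := set21 q1 q2; have := set22 q1 q2; rewrite -E.
move=> /setD1P[q2z /setD1P[q2y q2b]] /setD1P[q1z /setD1P[q1y q1b]].
exists q1, q2; split=> // [|q qb qy qz].
  by rewrite /= !inE !negb_or q12 q1y q1z q2y q2z yz.
by have := in_set2 q q1 q2; rewrite -E !inE qb qy qz.
Qed.

Lemma par_class_sub q t : q \in X -> t \in par_class Q q ->
  t \subset kpoints_of X /\ #|t| = 3.
Proof.
move=> qX /par_classP[->|b e bQ qb ->]; split.
- by apply/subsetP => -[[y s]|]; rewrite in_inf_triple in_kpoints_of // => /eqP->.
- exact: card_inf_triple.
- apply/subsetP => -[[y s]|]; rewrite in_kpoints_of // in_line.
  by case/and3P=> _ yb _; apply: block_mem yb.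
- by apply: card_line => //; apply: card_block.
Qed.

(** The triple must be a line on the block [b] through [y] and [z]. By [sign_split], exactly one of
    the two other points of [b] is a direction giving [y] and [z] the relative sign [s (+) r]; then
    [s] fixes which of its two lines is meant. *)
Lemma ktriples_line y z s r : y \in X -> z \in X -> y != z ->
  exists2 t, t \in ktriples X Q & [/\ Some (y, s) \in t, Some (z, r) \in t &
    forall t', t' \in ktriples X Q -> Some (y, s) \in t' -> Some (z, r) \in t' ->
      t' = t].
Proof.
move=> yX zX yz; have [b bQ /andP[yb zb]] := design_block hQ yX zX yz.
have [q1 [q2 [q1b q2b u q12]]] := two_other_points bQ yb zb yz.
have sep := sign_split (card_block bQ) (And4 q1b q2b yb zb) u.
have [q [qb qy qz Eq uq]] : exists q, [/\ q \in b, y != q, z != q,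
    sign b q y (+) sign b q z = s (+) r
  & forall q', q' \in b -> q' != y -> q' != z ->
      sign b q' y (+) sign b q' z = s (+) r -> q' = q].
  move: u; rewrite /= !inE !negb_or => /and4P[/and3P[_ q1y q1z] /andP[q2y q2z] _ _].
  have [E|E] := eqVneq (sign b q1 y (+) sign b q1 z) (s (+) r).
    exists q1; split=> //; do ?by rewrite eq_sym.
    move=> q qb qy qz; have /orP[/eqP->|/eqP->] // := q12 q qb qy qz.
    by move=> E2; move: sep; rewrite E E2 eqxx.
  exists q2; split=> //; do ?by rewrite eq_sym.
    (* Of two distinct booleans, one equals [s (+) r]. *)
    by move: sep E; case: (_ (+) _) (_ (+) _) (s (+) r) => [] [] [].
  move=> q qb qy qz; have /orP[/eqP->|/eqP->] // := q12 q qb qy qz.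
  by move=> E2; rewrite E2 eqxx in E.
(* This shift makes the line contain [y] with sign [s]. *)
exists (line b q (s (+) sign b q y)).
  apply/bigcupP; exists q; first exact: block_mem qb.
  exact/par_classP/(ParLine bQ qb).
split; rewrite ?in_line ?qy ?qz ?yb ?zb /=.
- by rewrite -addbA addbb addbF.
- by rewrite -addbA Eq addbA addbb.
move=> t /bigcupP[q' _ /par_classP[->|b' e b'Q q'b' ->]].
  by rewrite !in_inf_triple => /eqP /= yq /eqP /= zq; rewrite yq zq eqxx in yz.
rewrite !in_line => /and3P[yq' yb' /eqP Es] /and3P[zq' zb' /eqP Er].
have Eb := design_block_inj hQ yz b'Q bQ yb' zb' yb zb.
rewrite {}Eb in Es Er q'b' *.
have Eq' : q' = q.
  apply: uq; rewrite // 1?eq_sym // Es Er.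
  by case: e (sign _ _ y) (sign _ _ z) {Es Er} => [] [] [].
rewrite Eq' in Es *.
by congr (line _ _ _); rewrite Es -addbA addbb addbF.
Qed.

Lemma ktriples_infty y s t : t \in ktriples X Q ->
  Some (y, s) \in t -> infty T \in t -> t = inf_triple y.
Proof.
case/bigcupP=> q _ /par_classP[->|b e _ _ ->]; last by rewrite infty_line.
by rewrite !in_inf_triple => /eqP /= ->.
Qed.

Lemma ktriples_pair y s r t : t \in ktriples X Q ->
  Some (y, s) \in t -> Some (y, r) \in t -> s != r -> t = inf_triple y.
Proof.
case/bigcupP=> q _ /par_classP[->|b e _ _ ->].
  by rewrite !in_inf_triple => /eqP /= ->.
by rewrite !in_line => /and3P[_ _ /eqP->] /and3P[_ _ /eqP->]; rewrite eqxx.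
Qed.

Lemma inf_triple_ktriples y : y \in X -> inf_triple y \in ktriples X Q.
Proof. by move=> yX; apply/bigcupP; exists y => //; apply/par_classP/ParInf. Qed.

Lemma ktriples_design : steiner_triple_system (2 * v + 1) (kpoints_of X) (ktriples X Q).
Proof.
split; first by rewrite card_kpoints_of; case: hQ => ->.
  by move=> t /bigcupP[q qX /par_class_sub]; apply.
move=> x y xX yX xy.
suff [t tK [xt yt uni]] : exists2 t, t \in ktriples X Q & [/\ x \in t, y \in t &
    forall t', t' \in ktriples X Q -> x \in t' -> y \in t' -> t' = t].
  apply: (@card1_unique _ _ t); first by rewrite inE tK xt.
  by move=> t'; rewrite inE => /and3P[]; apply: uni.
(* Two distinct points lie over different points of [X], or are some [y] and [y'], or include
   infinity; only the first kind needs a line. *)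
move: x y xX yX xy => [[y s]|] [[z r]|] //; rewrite !in_kpoints_of /= => yX zX.
- have [->|yz] := eqVneq y z; last by move=> _; apply: ktriples_line.
  move=> nsr; have sr : s != r by apply: contraNneq nsr => ->.
  exists (inf_triple z); first exact: inf_triple_ktriples.
  by split; rewrite ?in_inf_triple // => t' tK ys zr; apply: ktriples_pair zr sr.
- move=> _; exists (inf_triple y); first exact: inf_triple_ktriples.
  by split; rewrite ?in_inf_triple // => t' tK ys oo; apply: ktriples_infty ys oo.
- move=> _; exists (inf_triple z); first exact: inf_triple_ktriples.
  by split; rewrite ?in_inf_triple // => t' tK oo zr; apply: ktriples_infty zr oo.
Qed.

(** A line on [b] with direction [q] lies over [b :\ q]. Two of these points determine [b], and [q]
    is then the point of [b] left out. *)
Lemma par_class_inj q1 q2 t : t \in par_class Q q1 -> t \in par_class Q q2 ->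
  q1 = q2.
Proof.
case/par_classP=> [->|b1 e1 b1Q q1b1 ->]; case/par_classP=> [|b2 e2 b2Q q2b2].
- exact: inf_triple_inj.
- by move/inf_triple_neq_line.
- by move/esym/inf_triple_neq_line.
move=> E.
have supp y : y != q1 -> y \in b1 -> (y != q2) && (y \in b2).
  by move=> yq yb; have := mem_line e1 yq yb; rewrite E in_line => /and3P[-> ->].
have /card_gt1P[y [z [/setD1P[yq yb] /setD1P[zq zb] yz]]] : 1 < #|b1 :\ q1|.
  by have := cardsD1 q1 b1; rewrite q1b1 card_block // add1n => -[<-].
have /andP[_ yb2] := supp y yq yb; have /andP[_ zb2] := supp z zq zb.
have Eb := design_block_inj hQ yz b1Q b2Q yb zb yb2 zb2.
(* Otherwise [q2] would be in [b1 :\ q1], although the second line has no point over [q2]. *)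
apply/eqP/negPn/negP => q12; rewrite eq_sym in q12.
by have := supp q2 q12; rewrite Eb q2b2 eqxx => /(_ isT).
Qed.

(** A point over [y] other than [q] is covered through the unique block containing [y] and [q]: the
    two parallel lines there take opposite signs at [y]. *)
Lemma par_class_partition q : q \in X ->
  partition (par_class Q q) (kpoints_of X).
Proof.
move=> qX; apply: partition_unique => [t /par_class_sub[]//|t /par_class_sub[]//||].
- by move=> _ ct; rewrite -card_gt0 ct.
- move=> x xX; have [xq|] := boolP (x \in inf_triple q).
    by exists (inf_triple q) => //; apply/par_classP/ParInf.
  case: x xX => [[y s]|]; rewrite in_inf_triple in_kpoints_of //= => yX yq.
  have [b bQ /andP[yb qb]] := design_block hQ yX qX yq.
  exists (line b q (s (+) sign b q y)); first exact/par_classP/(ParLine bQ qb).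
  by rewrite in_line yq yb -addbA addbb addbF /=.
have inf_line x b e : x \in inf_triple q -> x \in line b q e -> False.
  case: x => [[y s]|]; last by rewrite infty_line.
  by rewrite in_inf_triple in_line => /= ->.
move=> x t1 t2 /par_classP[->|b1 e1 b1Q qb1 ->] /par_classP[->|b2 e2 b2Q qb2 ->] //.
- by move=> x1 x2; case: (inf_line _ _ _ x1 x2).
- by move=> x1 x2; case: (inf_line _ _ _ x2 x1).
case: x => [[y s]|]; last by rewrite infty_line.
rewrite !in_line => /and3P[yq yb1 /eqP->] /and3P[_ yb2].
rewrite (design_block_inj hQ yq b1Q b2Q yb1 qb1 yb2 qb2) => /eqP E.
by rewrite (addIb E).
Qed.

Lemma kclasses_resolution : resolution (kpoints_of X) (ktriples X Q) (kclasses X Q).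
Proof.
have sub q : q \in X -> par_class Q q \subset ktriples X Q.
  by move=> qX; apply: bigcup_sup.
split; last first.
  by move=> _ /imsetP[q qX ->]; split; [apply: sub|apply: par_class_partition].
apply: partition_unique => [_ /imsetP[q qX ->]|_ /imsetP[q qX ->]||].
- exact: sub.
- by apply/set0Pn; exists (inf_triple q); apply/par_classP/ParInf.
- by move=> t /bigcupP[q qX tq]; exists (par_class Q q) => //; apply: imset_f.
by move=> t _ _ /imsetP[q1 _ ->] /imsetP[q2 _ ->] t1 t2; rewrite (par_class_inj t1 t2).
Qed.

Lemma ktriples_kirkman :
  kirkman_triple_system (2 * v + 1) (kpoints_of X) (ktriples X Q) (kclasses X Q).
Proof. by split; [apply: ktriples_design|apply: kclasses_resolution]. Qed.

End QuadrupleSystem.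

(** * The placement on a single block, as the case of order 4 *)

Lemma block_quadruple_system b : #|b| = 4 -> quadruple_system 4 b [set b].
Proof.
move=> cb; split=> // [b' /set1P->|x y xb yb _] //.
apply: (@card1_unique _ _ b) => [|b']; first by rewrite !inE eqxx xb yb.
by rewrite !inE => /andP[/eqP].
Qed.

Lemma ktriples_placement b : #|b| = 4 -> placement b (ktriples b [set b]).
Proof.
move=> cb; have hb := block_quadruple_system cb; split.
  by exists (kclasses b [set b]); apply: ktriples_kirkman hb.
apply/setP => t; rewrite inE; apply/andP/imsetP => [[]|[q qb ->]].
  case/bigcupP=> q qb /par_classP[->|b' e _ _ ->]; last by rewrite infty_line.
  by exists q.
by rewrite in_inf_triple; split=> //; apply: inf_triple_ktriples.
Qed.

Lemma ktriples_KQ Q :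
  ktriples [set: T] Q = KQ_triples Q (fun b => ktriples b [set b]).
Proof.
apply/setP => t; apply/bigcupP/setUP => [[q _]|[/imsetP[q _ ->]|/bigcupP[b bQ]]].
- case/par_classP=> [->|b e bQ qb ->]; first by left; apply: imset_f.
  right; apply/bigcupP; exists b => //; apply/bigcupP; exists q => //.
  exact/par_classP/(ParLine (set11 b) qb).
- by exists q => //; apply/par_classP/ParInf.
case/bigcupP=> q qb /par_classP[->|b' e /set1P-> _ ->]; exists q => //.
  exact/par_classP/ParInf.
exact/par_classP/(ParLine bQ qb).
Qed.

Lemma kpoints_ofT : kpoints_of [set: T] = [set: kpoint T].
Proof. by apply/setP => -[[y s]|]; rewrite in_kpoints_of !inE. Qed.

(** * The colouring, where [lift ord_max] embeds the old colours away from the new one *)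

Definition kcolour d (c : T -> 'I_d) (p : kpoint T) : 'I_d.+1 :=
  if p is Some (y, _) then lift ord_max (c y) else ord_max.

Lemma inf_triple_not_mono d (c : T -> 'I_d) q :
  ~ monochromatic (kcolour c) (inf_triple q).
Proof.
move/(_ (infty T) (plain q)); rewrite !in_inf_triple /= eqxx => /(_ isT isT).
by move/eqP; rewrite (negPf (neq_lift _ _)).
Qed.

(** A monochromatic line would give all of [b :\ q] one colour, leaving at most two colours on
    [b]. *)
Lemma line_not_mono d (c : T -> 'I_d) b q e :
  2 < #|c @: b| -> q \in b -> ~ monochromatic (kcolour c) (line b q e).
Proof.
move=> cb qb mono.
suff [x cx] : exists x, c @: b \subset [set c q; x].
  by move: cb; rewrite ltnNge (leq_trans (subset_leq_card cx)) // cards2; case: eqP.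
(* If [b] is just [q], the witness [c q] is a dummy; otherwise it is the common colour of
   [b :\ q]. *)
have [b0|[y /setD1P[yq yb]]] := set_0Vmem (b :\ q).
  exists (c q); apply/subsetP => _ /imsetP[z zb ->]; rewrite !inE orbb.
  apply/eqP; congr c; apply/eqP/negPn/negP => zq.
  by have := in_set0 z; rewrite -b0 !inE zq zb.
exists (c y); apply/subsetP => _ /imsetP[z zb ->]; rewrite !inE.
have [->|zq] := eqVneq z q; first by rewrite eqxx.
have := mono _ _ (mem_line e zq zb) (mem_line e yq yb).
by move/lift_inj->; rewrite eqxx orbT.
Qed.

End Lines.

Theorem theorem6p5 (v d : nat) (T : finType) (Q : {set {set T}})
    (c : T -> 'I_d)
    (hQ : quadruple_system v [set: T] Q)
    (hc : forall b : {set T}, b \in Q -> 3 <= #|c @: b|) :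
  exists (K : {set {set kpoint T}}) (R : {set {set {set kpoint T}}}),
    [/\ is_KQ Q K R,
        kirkman_triple_system (2 * v + 1) [set: kpoint T] K R
      & colourable d.+1 K].
Proof.
have kK := ktriples_kirkman hQ; rewrite kpoints_ofT in kK.
exists (ktriples [set: T] Q), (kclasses [set: T] Q); split=> //.
  split; first by have [cT _ _] := hQ; rewrite -cardsT cT.
  exists (fun b => ktriples b [set b]); split=> [b bQ|]; last exact: ktriples_KQ.
  by apply: ktriples_placement; have [_ /(_ b bQ)[]] := hQ.
exists (kcolour c) => t /bigcupP[q _ /par_classP[->|b e bQ qb ->]].
  exact: inf_triple_not_mono.
by apply: line_not_mono qb; apply: hc.
Qed.
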